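(* Let $X$ be a connected, locally path connected space, let $x\in X$, and let $H$ be a subgroup of $\pi_1(X,x)$. There exists a semicovering $p:\widetilde{X}\to X$ such that $p_*\pi_1(\widetilde{X},\tilde{x})=H$ for some $\tilde{x}\in p^{-1}(x)$ if and only if there is a path open cover $\mathcal{V}$ of $(X,x)$ such that $\widetilde{\pi}(\mathcal{V},x)\leq H$.
   Context: $P(X,x)$ is the space of all paths $\alpha:[0,1]\to X$ with $\alpha(0)=x$, with the compact-open topology. A path open cover of a pointed space $(X,x)$ is an open cover $\mathcal{V}=\{V_{\alpha}\mid\alpha\in P(X,x)\}$ of $X$, indexed by $P(X,x)$, such that $\alpha(1)\in V_{\alpha}$ for every $\alpha\in P(X,x)$. The path Spanier group $\widetilde{\pi}(\mathcal{V},x)$ with respect to the path open cover $\mathcal{V}$ is the subgroup of $\pi_1(X,x)$ consisting of all homotopy classes having a representative of the form $\prod_{j=1}^{n}u_jv_ju_j^{-1}$, where each $u_j$ is an arbitrary path starting at $x$ and each $v_j$ is a loop based at $u_j(1)$ lying inside $V_{u_j}$. A semicovering (in the sense of Brazas) is a local homeomorphism $p:Y\to X$ with continuous lifting of paths and homotopies. Continuous lifting of paths means that for every $y\in Y$ the map $P(Y,y)\to P(X,p(y))$, $\alpha\mapsto p\circ\alpha$, is a homeomorphism. Continuous lifting of homotopies means that for every $y\in Y$ the map $\Phi(Y,y)\to\Phi(X,p(y))$, $\phi\mapsto p\circ\phi$, is a homeomorphism, where $\Phi(Z,z)$ denotes the space, with the compact-open topology, of continuous maps $(D^2,d)\to(Z,z)$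 from the closed unit disk $D^2$ with basepoint $d=(1,0)$. *)

(* Defs.v *)
From HB Require Import structures.
From mathcomp Require Import all_boot all_order all_algebra generic_quotient.
From mathcomp Require Import ring lra.
From mathcomp Require Import all_classical all_reals topology normedtype.
From mathcomp Require Import homotopy.

Set Implicit Arguments.
Unset Strict Implicit.
Unset Printing Implicit Defensive.
Import Order.TTheory GRing.Theory Num.Theory.
Import numFieldNormedType.Exports.

Local Open Scope classical_set_scope.
Local Open Scope ring_scope.
Local Open Scope quotient_scope.

Definition unit_interval (R : realType) : Type := `[0 : R, 1]%classic.

HB.instance Definition _ (R : realType) :=
  Topological.copy (unit_interval R) (set_type `[0 : R, 1]%classic).

Section UnitInterval.
Context {R : realType}.
Local Notation I := (unit_interval R).

Definition ival : I -> R := set_val.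

Lemma ival_itv (t : I) : 0 <= ival t <= 1.
Proof. by case: t => t tI; have := set_mem tI; rewrite /= in_itv. Qed.

Lemma ival_inj : injective ival.
Proof. exact: val_inj. Qed.

Lemma ival_continuous : continuous ival.
Proof. exact: initial_continuous. Qed.

Lemma clamp_subproof (r : R) :
  Order.max 0 (Order.min 1 r) \in `[0 : R, 1]%classic.
Proof.
apply/mem_set; rewrite /= in_itv /=.
by rewrite le_max lexx /= ge_max ler01 ge_min lexx.
Qed.

Definition clamp (r : R) : I :=
  exist (fun r => r \in `[0 : R, 1]%classic) _ (clamp_subproof r).

Lemma clampE (r : R) : 0 <= r <= 1 -> ival (clamp r) = r.
Proof.
by move=> /andP[r0 r1]; rewrite /ival set_valE /= min_r // max_r.
Qed.

Lemma clamp_ival (t : I) : clamp (ival t) = t.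
Proof. by apply: ival_inj; rewrite clampE ?ival_itv. Qed.

Lemma clamp_continuous : continuous clamp.
Proof.
apply: continuous_comp_initial => r /=.
apply: continuous_max; first exact: cvg_cst.
apply: continuous_min; first exact: cvg_cst.
exact: cvg_id.
Qed.

Lemma clamp01_subproof : clamp 0 != clamp 1.
Proof.
apply/eqP => /(congr1 ival); rewrite !clampE ?lexx ?ler01 // => /esym/eqP.
by rewrite oner_eq0.
Qed.

End UnitInterval.

HB.instance Definition _ (R : realType) :=
  isBiPointed.Build (unit_interval R) (@clamp01_subproof R).

Section UnitIntervalEnds.
Context {R : realType}.
Local Notation I := (unit_interval R).

Lemma ival0 : ival (zero : I) = 0.
Proof. by rewrite clampE ?lexx ?ler01. Qed.

Lemma ival1 : ival (one : I) = 1.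
Proof. by rewrite clampE ?lexx ?ler01. Qed.

Lemma clamp0 : clamp (0 : R) = zero.
Proof. by []. Qed.

Lemma clamp1 : clamp (1 : R) = one.
Proof. by []. Qed.

Lemma clamp_le0 (r : R) : r <= 0 -> clamp r = zero :> I.
Proof.
move=> r0; apply: ival_inj; rewrite ival0 /ival set_valE /=.
by rewrite min_r ?(le_trans r0) // max_l.
Qed.

Lemma clamp_ge1 (r : R) : 1 <= r -> clamp r = one :> I.
Proof.
move=> r1; apply: ival_inj; rewrite ival1 /ival set_valE /=.
by rewrite min_l // max_r.
Qed.

Lemma affine_continuous (a b : R) :
  continuous (fun t : I => a * ival t + b).
Proof.
move=> t; apply: (@continuousD _ R^o _ (fun t : I => a * ival t) (cst b));
  last exact: cst_continuous.
apply: (@continuousM _ _ (cst a) ival); first exact: cst_continuous.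
exact: ival_continuous.
Qed.

End UnitIntervalEnds.

Lemma paste_continuous (R : realType) (T U : topologicalType) (s : T -> R)
    (f g : T -> U) :
  continuous s -> continuous f -> continuous g ->
  (forall t, s t = 2^-1 -> f t = g t) ->
  continuous (fun t => if s t <= 2^-1 then f t else g t).
Proof.
move=> cs cf cg fg; set h := fun t => _.
have cA : closed [set t | s t <= 2^-1].
  have -> : [set t | s t <= 2^-1] = s @^-1` [set r | r <= 2^-1] by [].
  by apply: preimage_closed => //; exact: closed_le.
have cB : closed [set t | s t >= 2^-1].
  have -> : [set t | s t >= 2^-1] = s @^-1` [set r | r >= 2^-1] by [].
  by apply: preimage_closed => //; exact: closed_ge.
have ABT : [set t | s t <= 2^-1] `|` [set t | s t >= 2^-1] = setT.
  by apply/seteqP; split=> // t _ /=; apply/orP; exact: le_total.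
apply/continuous_subspace_setT; rewrite -ABT.
apply: withinU_continuous => //.
  apply: (@subspace_eq_continuous _ _ _ f); last exact: continuous_subspaceT.
  by move=> t /set_mem /= st; rewrite /from_subspace/= /h; move: st => ->.
apply: (@subspace_eq_continuous _ _ _ g); last exact: continuous_subspaceT.
move=> t /set_mem /= st; rewrite /from_subspace/= /h; case: ifPn => // st'.
by apply/esym/fg/le_anti; rewrite st' andTb; exact: st.
Qed.

Lemma pair_continuous (T U V : topologicalType) (f : T -> U) (g : T -> V) :
  continuous f -> continuous g -> continuous (fun t => (f t, g t)).
Proof. by move=> cf cg t; exact: (cvg_pair (cf t) (cg t)). Qed.

Lemma fst_continuous (T U : topologicalType) : continuous (@fst T U).
Proof. by move=> t; exact: cvg_fst. Qed.

Lemma snd_continuous (T U : topologicalType) : continuous (@snd T U).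
Proof. by move=> t; exact: cvg_snd. Qed.

Section PathHomotopy.
Context {R : realType} {X : topologicalType}.
Local Notation I := (unit_interval R).
Implicit Types x y z : X.

(* F (t, s): t is the path parameter, s the homotopy parameter. *)
Definition path_homotopic x y (f g : {path I from x to y in X}) : Prop :=
  exists F : I * I -> X,
    [/\ continuous F, (forall t, F (t, zero) = f t), (forall t, F (t, one) = g t)
      & forall s, F (zero, s) = x /\ F (one, s) = y].

Definition concat_fun x y z (f : {path I from x to y in X})
    (g : {path I from y to z in X}) (t : I) : X :=
  if ival t <= 2^-1 then f (clamp (2 * ival t)) else g (clamp (2 * ival t - 1)).

Lemma ival_affine_continuous (a b : R) :
  continuous (fun t : I => clamp (a * ival t + b)).
Proof.
move=> t; apply: (@continuous_comp _ _ _ (fun t : I => a * ival t + b)).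
  exact: affine_continuous.
exact: clamp_continuous.
Qed.

Section Concat.
Context x y z (f : {path I from x to y in X}) (g : {path I from y to z in X}).

Lemma concat_continuous : continuous (concat_fun f g).
Proof.
apply: (@paste_continuous R _ _ ival (fun t => f (clamp (2 * ival t)))
  (fun t => g (clamp (2 * ival t - 1)))).
- exact: ival_continuous.
- move=> t; apply: (@continuous_comp _ _ _ (fun t => clamp (2 * ival t)) f);
    last exact: cts_fun.
  have := @ival_affine_continuous 2 0 t.
  by rewrite (_ : (fun t => _) = (fun t => clamp (2 * ival t))) //;
    apply/funext => u; rewrite addr0.
- move=> t; apply: (@continuous_comp _ _ _ (fun t => clamp (2 * ival t - 1)) g);
    last exact: cts_fun.
  exact: ival_affine_continuous.
- move=> t ->; rewrite divff ?pnatr_eq0 // subrr clamp0 clamp1.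
  by rewrite path_one path_zero.
Qed.

Lemma concat0 : concat_fun f g zero = x.
Proof.
by rewrite /concat_fun ival0 invr_ge0 ler0n mulr0 clamp0 path_zero.
Qed.

Lemma concat1 : concat_fun f g one = z.
Proof.
rewrite /concat_fun ival1; have -> : (1 <= 2^-1 :> R) = false by lra.
have -> : 2 * 1 - 1 = 1 :> R by ring.
by rewrite clamp1 path_one.
Qed.

Definition concat : {path I from x to z in X} :=
  mk_path concat_continuous concat0 concat1.

Lemma concatEl (t : I) :
  ival t <= 2^-1 -> concat t = f (clamp (2 * ival t)).
Proof. by rewrite /concat /= /mk_path /concat_fun => ->. Qed.

Lemma concatEr (t : I) :
  2^-1 < ival t -> concat t = g (clamp (2 * ival t - 1)).
Proof. by rewrite /concat /= /mk_path /concat_fun leNgt => ->. Qed.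

End Concat.

Section Reverse.
Context x y (f : {path I from x to y in X}).

Definition reverse_fun (t : I) : X := f (clamp (1 - ival t)).

Lemma reverse_continuous : continuous reverse_fun.
Proof.
move=> t; apply: (@continuous_comp _ _ _ (fun t => clamp (1 - ival t)) f);
  last exact: cts_fun.
have := @ival_affine_continuous (-1) 1 t.
by rewrite (_ : (fun t => _) = (fun t => clamp (1 - ival t))) //;
  apply/funext => u; rewrite mulN1r addrC.
Qed.

Lemma reverse0 : reverse_fun zero = y.
Proof. by rewrite /reverse_fun ival0 subr0 clamp1 path_one. Qed.

Lemma reverse1 : reverse_fun one = x.
Proof. by rewrite /reverse_fun ival1 subrr clamp0 path_zero. Qed.

Definition reverse : {path I from y to x in X} :=
  mk_path reverse_continuous reverse0 reverse1.

End Reverse.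

Definition const_path x : {path I from x to x in X} := cst x.

Lemma homotopic_reparam (p : I -> X) (u v : I -> I) x y
    (f g : {path I from x to y in X}) :
  continuous p -> continuous u -> continuous v ->
  u zero = v zero -> u one = v one ->
  (forall t, f t = p (u t)) -> (forall t, g t = p (v t)) ->
  path_homotopic f g.
Proof.
move=> cp cu cv uv0 uv1 fE gE.
exists (fun ts => p (clamp ((1 - ival ts.2) * ival (u ts.1)
                             + ival ts.2 * ival (v ts.1)))); split.
- move=> ts; apply: (@continuous_comp _ _ _ (fun ts : I * I =>
    clamp ((1 - ival ts.2) * ival (u ts.1) + ival ts.2 * ival (v ts.1))) p);
    last exact: cp.
  apply: (@continuous_comp _ _ _ (fun ts : I * I =>
    (1 - ival ts.2) * ival (u ts.1) + ival ts.2 * ival (v ts.1)));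
    last exact: clamp_continuous.
  have c2 : {for ts, continuous (fun ts : I * I => ival ts.2)}.
    apply: (@continuous_comp _ _ _ snd ival); first exact: cvg_snd.
    exact: ival_continuous.
  have c1 (w : I -> I) : continuous w ->
      {for ts, continuous (fun ts : I * I => ival (w ts.1))}.
    move=> cw; apply: (@continuous_comp _ _ _ fst (ival \o w)).
      exact: cvg_fst.
    by apply: continuous_comp; [exact: cw|exact: ival_continuous].
  apply: (@continuousD _ R^o _ (fun ts => (1 - ival ts.2) * ival (u ts.1))
    (fun ts => ival ts.2 * ival (v ts.1))).
    apply: (@continuousM _ _ (fun ts => 1 - ival ts.2)
      (fun ts => ival (u ts.1))); last exact: c1.
    apply: (@continuousB _ R^o _ (cst 1) (fun ts => ival ts.2)) => //.
    exact: cst_continuous.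
  apply: (@continuousM _ _ (fun ts => ival ts.2) (fun ts => ival (v ts.1))) => //.
  exact: c1.
- by move=> t /=; rewrite ival0 subr0 mul1r mul0r addr0 clamp_ival fE.
- by move=> t /=; rewrite ival1 subrr mul1r mul0r add0r clamp_ival gE.
- move=> s /=; rewrite -uv0 -uv1 -!mulrDl subrK !mul1r !clamp_ival -!fE.
  by rewrite path_zero path_one.
Qed.

Lemma path_homotopic_refl x y (f : {path I from x to y in X}) :
  path_homotopic f f.
Proof.
apply: (@homotopic_reparam f id id) => //; first exact: cts_fun.
- by move=> ?; exact: cvg_id.
- by move=> ?; exact: cvg_id.
Qed.

Lemma path_homotopic_sym x y (f g : {path I from x to y in X}) :
  path_homotopic f g -> path_homotopic g f.
Proof.
case=> F [cF F0 F1 Fxy].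
exists (fun ts => F (ts.1, clamp (1 - ival ts.2))); split.
- move=> ts; apply: (@continuous_comp _ _ _
    (fun ts : I * I => (ts.1, clamp (1 - ival ts.2)))); last exact: cF.
  apply: (@pair_continuous _ _ _ fst); first exact: fst_continuous.
  move=> {}ts.
  apply: (@continuous_comp _ _ _ snd (fun s : I => clamp (1 - ival s))).
    exact: cvg_snd.
  have := @ival_affine_continuous (-1) 1 ts.2.
  by rewrite (_ : (fun t => _) = (fun t => clamp (1 - ival t))) //;
    apply/funext => u; rewrite mulN1r addrC.
- by move=> t /=; rewrite ival0 subr0 clamp1.
- by move=> t /=; rewrite ival1 subrr clamp0.
- by move=> s /=; exact: Fxy.
Qed.

Lemma homotopy_affine_continuous (F : I * I -> X) (a b : R) : continuous F ->
  continuous (fun ts : I * I => F (ts.1, clamp (a * ival ts.2 + b))) /\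
  continuous (fun ts : I * I => F (clamp (a * ival ts.1 + b), ts.2)).
Proof.
move=> cF; split=> ts.
- apply: (@continuous_comp _ _ _
    (fun ts : I * I => (ts.1, clamp (a * ival ts.2 + b)))); last exact: cF.
  apply: (@pair_continuous _ _ _ fst); first exact: fst_continuous.
  move=> {}ts.
  apply: (@continuous_comp _ _ _ snd (fun s : I => clamp (a * ival s + b))).
    exact: cvg_snd.
  exact: ival_affine_continuous.
- apply: (@continuous_comp _ _ _
    (fun ts : I * I => (clamp (a * ival ts.1 + b), ts.2))); last exact: cF.
  apply: (@pair_continuous _ _ _ _ snd); last exact: snd_continuous.
  move=> {}ts.
  apply: (@continuous_comp _ _ _ fst (fun s : I => clamp (a * ival s + b))).
    exact: cvg_fst.
  exact: ival_affine_continuous.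
Qed.

Lemma ival_fst_continuous : continuous (fun ts : I * I => ival ts.1).
Proof.
move=> ts; apply: (@continuous_comp _ _ _ fst ival); first exact: cvg_fst.
exact: ival_continuous.
Qed.

Lemma ival_snd_continuous : continuous (fun ts : I * I => ival ts.2).
Proof.
move=> ts; apply: (@continuous_comp _ _ _ snd ival); first exact: cvg_snd.
exact: ival_continuous.
Qed.

Lemma path_homotopic_trans x y (f g h : {path I from x to y in X}) :
  path_homotopic f g -> path_homotopic g h -> path_homotopic f h.
Proof.
case=> F [cF F0 F1 Fxy] [G [cG G0 G1 Gxy]].
exists (fun ts => if ival ts.2 <= 2^-1 then F (ts.1, clamp (2 * ival ts.2 + 0))
                  else G (ts.1, clamp (2 * ival ts.2 + -1))); split.
- apply: (@paste_continuous R _ _ (fun ts : I * I => ival ts.2)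
    (fun ts : I * I => F (ts.1, clamp (2 * ival ts.2 + 0)))
    (fun ts : I * I => G (ts.1, clamp (2 * ival ts.2 + -1)))).
  + exact: ival_snd_continuous.
  + by have [] := @homotopy_affine_continuous F 2 0 cF.
  + by have [] := @homotopy_affine_continuous G 2 (-1) cG.
  + move=> [t s] /= ->; rewrite divff ?pnatr_eq0 // addr0 subrr clamp0 clamp1.
    by rewrite F1 G0.
- by move=> t /=; rewrite ival0 invr_ge0 ler0n mulr0 addr0 clamp0.
- move=> t /=; rewrite ival1; have -> : (1 <= 2^-1 :> R) = false by lra.
  have -> : 2 * 1 + -1 = 1 :> R by ring.
  by rewrite clamp1.
- by move=> s /=; case: ifP => _; [exact: Fxy|exact: Gxy].
Qed.

Lemma path_homotopic_concat x y z (f f' : {path I from x to y in X})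
    (g g' : {path I from y to z in X}) :
  path_homotopic f f' -> path_homotopic g g' ->
  path_homotopic (concat f g) (concat f' g').
Proof.
case=> F [cF F0 F1 Fxy] [G [cG G0 G1 Gxy]].
exists (fun ts => if ival ts.1 <= 2^-1 then F (clamp (2 * ival ts.1 + 0), ts.2)
                  else G (clamp (2 * ival ts.1 + -1), ts.2)); split.
- apply: (@paste_continuous R _ _ (fun ts : I * I => ival ts.1)
    (fun ts : I * I => F (clamp (2 * ival ts.1 + 0), ts.2))
    (fun ts : I * I => G (clamp (2 * ival ts.1 + -1), ts.2))).
  + exact: ival_fst_continuous.
  + by have [] := @homotopy_affine_continuous F 2 0 cF.
  + by have [] := @homotopy_affine_continuous G 2 (-1) cG.
  + move=> [t s] /= ->; rewrite divff ?pnatr_eq0 // addr0 subrr clamp0 clamp1.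
    by rewrite (Fxy s).2 (Gxy s).1.
- by move=> t /=; rewrite F0 G0 addr0.
- by move=> t /=; rewrite F1 G1 addr0.
- move=> s /=; split.
    by rewrite ival0 invr_ge0 ler0n mulr0 addr0 clamp0 (Fxy s).1.
  rewrite ival1; have -> : (1 <= 2^-1 :> R) = false by lra.
  have -> : 2 * 1 + -1 = 1 :> R by ring.
  by rewrite clamp1 (Gxy s).2.
Qed.

Lemma path_homotopic_reverse x y (f f' : {path I from x to y in X}) :
  path_homotopic f f' -> path_homotopic (reverse f) (reverse f').
Proof.
case=> F [cF F0 F1 Fxy].
exists (fun ts => F (clamp (-1 * ival ts.1 + 1), ts.2)); split.
- by have [] := @homotopy_affine_continuous F (-1) 1 cF.
- by move=> t /=; rewrite F0 mulN1r addrC.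
- by move=> t /=; rewrite F1 mulN1r addrC.
- move=> s /=; rewrite ival0 ival1 mulr0 add0r mulr1 addNr clamp0 clamp1.
  by rewrite (Fxy s).1 (Fxy s).2.
Qed.

Lemma concat_constl x y (f : {path I from x to y in X}) :
  path_homotopic (concat (const_path x) f) f.
Proof.
apply: (@homotopic_reparam f (fun t => clamp (2 * ival t + -1)) id) => //.
- exact: cts_fun.
- exact: ival_affine_continuous.
- by move=> ?; exact: cvg_id.
- by rewrite clamp_le0 // ival0 mulr0 add0r oppr_le0 ler01.
- by rewrite ival1 -clamp1; congr clamp; ring.
- move=> t; rewrite /concat /= /mk_path /= /concat_fun; case: ifPn => // t2.
  have -> : clamp (2 * ival t + -1) = zero by apply: clamp_le0; lra.
  by rewrite path_zero.
Qed.

Lemma concat_constr x y (f : {path I from x to y in X}) :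
  path_homotopic (concat f (const_path y)) f.
Proof.
apply: (@homotopic_reparam f (fun t => clamp (2 * ival t + 0)) id) => //.
- exact: cts_fun.
- exact: ival_affine_continuous.
- by move=> ?; exact: cvg_id.
- by rewrite ival0 mulr0 addr0 clamp0.
- by rewrite ival1 clamp_ge1 //; lra.
- move=> t; rewrite addr0 /concat /= /mk_path /= /concat_fun.
  case: ifPn => // t2.
  have -> : clamp (2 * ival t) = one by apply: clamp_ge1; lra.
  by rewrite path_one.
Qed.

Lemma concat_reverser x y (f : {path I from x to y in X}) :
  path_homotopic (concat f (reverse f)) (const_path x).
Proof.
apply: (@homotopic_reparam f (fun t => clamp (Order.min (2 * ival t + 0)
   (- 2 * ival t + 2))) (fun=> zero)) => //.
- exact: cts_fun.
- move=> t; apply: (@continuous_comp _ _ _ (fun t : I =>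
    Order.min (2 * ival t + 0) (- 2 * ival t + 2)));
    last exact: clamp_continuous.
  by apply: continuous_min; exact: affine_continuous.
- exact: cst_continuous.
- by rewrite ival0 mulr0 addr0 clamp_le0 // ge_min lexx.
- rewrite ival1 clamp_le0 // ge_min; apply/orP; right; lra.
- move=> t; have := ival_itv t; rewrite addr0 /concat /= /mk_path /= /concat_fun.
  move=> /andP[t0 t1]; case: ifPn => t2.
    by rewrite min_l //; lra.
  rewrite /reverse /= /mk_path /reverse_fun clampE; last by apply/andP; lra.
  by rewrite min_r; [congr (f (clamp _)); ring|lra].
- by move=> t; rewrite path_zero.
Qed.

Lemma reverseK x y (f : {path I from x to y in X}) : reverse (reverse f) =1 f.
Proof.
move=> t; rewrite /reverse /= /mk_path /reverse_fun /= /mk_path clampE.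
  by rewrite opprB addrC subrK clamp_ival.
by have := ival_itv t; lra.
Qed.

Lemma concat_reversel x y (f : {path I from x to y in X}) :
  path_homotopic (concat (reverse f) f) (const_path y).
Proof.
have := concat_reverser (reverse f).
congr path_homotopic; apply/path_eqP => t.
by rewrite /concat /= /mk_path /concat_fun; case: ifP => _ //; exact: reverseK.
Qed.

Lemma concatA x y z w (f : {path I from x to y in X})
    (g : {path I from y to z in X}) (h : {path I from z to w in X}) :
  path_homotopic (concat f (concat g h)) (concat (concat f g) h).
Proof.
apply/path_homotopic_sym.
apply: (@homotopic_reparam (concat f (concat g h)) (fun t =>
   clamp (Order.min (2 * ival t + 0)
     (Order.min (1 * ival t + 4^-1) (2^-1 * ival t + 2^-1)))) id) => //.
- exact: cts_fun.
- move=> t; apply: (@continuous_comp _ _ _ (fun t : I =>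
    Order.min (2 * ival t + 0)
      (Order.min (1 * ival t + 4^-1) (2^-1 * ival t + 2^-1))));
    last exact: clamp_continuous.
  apply: continuous_min; first exact: affine_continuous.
  by apply: continuous_min; exact: affine_continuous.
- by move=> ?; exact: cvg_id.
- by rewrite ival0 mulr0 addr0 clamp_le0 // ge_min lexx.
- by rewrite ival1 clamp_ge1 // !le_min; apply/and3P; split; lra.
- move=> t; have /andP[t0 t1] := ival_itv t.
  set r := Order.min _ _.
  case: (leP (ival t) 2^-1) => t2; last first.
    have rE : r = 2^-1 * ival t + 2^-1.
      by rewrite /r [Order.min (_ * _ + 4^-1) _]min_r ?min_r //; lra.
    have rI : ival (clamp r) = r by rewrite clampE // rE; apply/andP; lra.
    have sI : ival (clamp (2 * r - 1)) = 2 * r - 1.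
      by rewrite clampE // rE; apply/andP; lra.
    rewrite [LHS]concatEr //.
    rewrite [RHS]concatEr; last by rewrite rI rE; lra.
    rewrite [RHS]concatEr rI; last by rewrite sI rE; lra.
    by rewrite sI rE; congr (h (clamp _)); field.
  rewrite concatEl //.
  have tI : ival (clamp (2 * ival t)) = 2 * ival t.
    by rewrite clampE //; apply/andP; lra.
  case: (leP (2 * ival t) 2^-1) => t4.
    have rE : r = 2 * ival t.
      by rewrite /r min_l ?addr0 // le_min; apply/andP; lra.
    rewrite [LHS]concatEl; last by rewrite tI.
    by rewrite [RHS]concatEl rE tI.
  have rE : r = ival t + 4^-1.
    by rewrite /r [Order.min (1 * _ + _) _]min_l ?min_r ?mul1r //; lra.
  have rI : ival (clamp r) = r by rewrite clampE // rE; apply/andP; lra.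
  have sI : ival (clamp (2 * r - 1)) = 2 * r - 1.
    by rewrite clampE // rE; apply/andP; lra.
  rewrite [LHS]concatEr; last by rewrite tI.
  rewrite [RHS]concatEr; last by rewrite rI rE; lra.
  rewrite [RHS]concatEl rI; last by rewrite sI rE; lra.
  by rewrite tI sI rE; congr (g (clamp _)); field.
Qed.

End PathHomotopy.

Section FundamentalGroup.
Context (R : realType) {X : topologicalType} (x : X).
Local Notation I := (unit_interval R).
Local Notation loop := {path I from x to x in X}.

Definition loop_homotopicb (f g : loop) : bool := `[< path_homotopic f g >].

Lemma loop_homotopicb_refl : reflexive loop_homotopicb.
Proof. by move=> f; apply/asboolP; exact: path_homotopic_refl. Qed.

Lemma loop_homotopicb_sym : symmetric loop_homotopicb.
Proof.
by move=> f g; apply: asbool_equiv_eq; split; exact: path_homotopic_sym.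
Qed.

Lemma loop_homotopicb_trans : transitive loop_homotopicb.
Proof.
move=> g f h /asboolP fg /asboolP gh; apply/asboolP.
exact: path_homotopic_trans fg gh.
Qed.

Canonical loop_homotopy_rel :=
  EquivRel loop_homotopicb loop_homotopicb_refl loop_homotopicb_sym
    loop_homotopicb_trans.

Definition pi1 := {eq_quot loop_homotopy_rel}.

HB.instance Definition _ := Choice.on pi1.
HB.instance Definition _ := Quotient.on pi1.
HB.instance Definition _ := EqQuotient.on pi1.

Definition loop_class (f : loop) : pi1 := \pi_pi1 f.

Lemma loop_classP (f g : loop) :
  loop_class f = loop_class g <-> path_homotopic f g.
Proof.
by split=> [/eqmodP/asboolP //|fg]; apply/eqmodP/asboolP.
Qed.

Lemma loop_class_repr (a : pi1) : loop_class (repr a) = a.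
Proof. exact: reprK. Qed.

Lemma repr_loop_class (f : loop) : path_homotopic (repr (loop_class f)) f.
Proof. by apply/loop_classP; rewrite loop_class_repr. Qed.

Definition pi1_one : pi1 := loop_class (const_path x).
Definition pi1_mul (a b : pi1) : pi1 := loop_class (concat (repr a) (repr b)).
Definition pi1_inv (a : pi1) : pi1 := loop_class (reverse (repr a)).

Lemma pi1_mulE (f g : loop) :
  pi1_mul (loop_class f) (loop_class g) = loop_class (concat f g).
Proof.
by apply/loop_classP; apply: path_homotopic_concat; exact: repr_loop_class.
Qed.

Lemma pi1_invE (f : loop) : pi1_inv (loop_class f) = loop_class (reverse f).
Proof.
by apply/loop_classP; apply: path_homotopic_reverse; exact: repr_loop_class.
Qed.

Lemma pi1_mulA : associative pi1_mul.
Proof.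
move=> a b c; rewrite -(loop_class_repr a) -(loop_class_repr b).
rewrite -(loop_class_repr c) !pi1_mulE.
by apply/loop_classP; exact: concatA.
Qed.

Lemma pi1_mul1g : left_id pi1_one pi1_mul.
Proof.
move=> a; rewrite -(loop_class_repr a) pi1_mulE.
by apply/loop_classP; exact: concat_constl.
Qed.

Lemma pi1_mulg1 : right_id pi1_one pi1_mul.
Proof.
move=> a; rewrite -(loop_class_repr a) pi1_mulE.
by apply/loop_classP; exact: concat_constr.
Qed.

Lemma pi1_mulVg : left_inverse pi1_one pi1_inv pi1_mul.
Proof.
move=> a; rewrite -(loop_class_repr a) pi1_invE pi1_mulE.
by apply/loop_classP; exact: concat_reversel.
Qed.

Lemma pi1_mulgV : right_inverse pi1_one pi1_inv pi1_mul.
Proof.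
move=> a; rewrite -(loop_class_repr a) pi1_invE pi1_mulE.
by apply/loop_classP; exact: concat_reverser.
Qed.

HB.instance Definition _ := isGroup.Build pi1 pi1_mulA pi1_mul1g pi1_mulg1
  pi1_mulVg pi1_mulgV.

Lemma loop_class_concat (f g : loop) :
  loop_class (concat f g) = (loop_class f * loop_class g)%g.
Proof. by rewrite -pi1_mulE. Qed.

Lemma loop_class_reverse (f : loop) :
  loop_class (reverse f) = ((loop_class f)^-1)%g.
Proof. by rewrite -pi1_invE. Qed.

Lemma loop_class_const : loop_class (const_path x) = 1%g.
Proof. by []. Qed.

End FundamentalGroup.

Section InducedMap.
Context {R : realType} {Y X : topologicalType} (p : continuousType Y X).
Context (y : Y) (x : X) (pyx : p y = x).
Local Notation I := (unit_interval R).

Section LoopImage.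
Context (f : {path I from y to y in Y}).

Lemma loop_image_continuous : continuous (p \o f).
Proof. exact: cts_fun. Qed.

Lemma loop_image0 : (p \o f) zero = x.
Proof. by rewrite /= path_zero. Qed.

Lemma loop_image1 : (p \o f) one = x.
Proof. by rewrite /= path_one. Qed.

Definition loop_image : {path I from x to x in X} :=
  mk_path loop_image_continuous loop_image0 loop_image1.

End LoopImage.

Definition pi1_map (a : pi1 R y) : pi1 R x := loop_class (loop_image (repr a)).

Lemma pi1_mapE (f : {path I from y to y in Y}) :
  pi1_map (loop_class f) = loop_class (loop_image f).
Proof.
apply/loop_classP; have [F [cF F0 F1 Fy]] := repr_loop_class f.
exists (p \o F); split.
- by move=> ts; apply: continuous_comp; [exact: cF|exact: cts_fun].
- by move=> t /=; rewrite F0.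
- by move=> t /=; rewrite F1.
- by move=> s /=; rewrite (Fy s).1 (Fy s).2 pyx.
Qed.

End InducedMap.

(* The subtype of a set of functions in {compact-open, Z -> X} carries the
   subspace topology. *)
Definition pointed_maps (Z X : topologicalType) (z : Z) (x : X) :
    set {compact-open, Z -> X} :=
  [set f | continuous (f : Z -> X) /\ f z = x].

(* Paths starting at x, with free endpoint. *)
Definition path_space (R : realType) (X : topologicalType) (x : X)
    : topologicalType :=
  pointed_maps (zero : unit_interval R) x.

Definition closed_disk (R : realType) : set (R * R)%type :=
  [set z | z.1 ^+ 2 + z.2 ^+ 2 <= 1].

Arguments closed_disk : clear implicits.

Lemma disk_base_subproof (R : realType) : (1, 0) \in closed_disk R.
Proof. by apply/mem_set; rewrite /closed_disk /= expr1n expr0n addr0. Qed.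

Definition disk_base (R : realType) : closed_disk R :=
  exist (fun z => z \in closed_disk R) (1, 0) (disk_base_subproof R).

(* Based maps (D^2, (1, 0)) -> (X, x). *)
Definition disk_space (R : realType) (X : topologicalType) (x : X)
    : topologicalType :=
  pointed_maps (disk_base R) x.

Definition homeomorphism (A B : topologicalType) (f : A -> B) : Prop :=
  continuous f /\
  exists g : B -> A, [/\ cancel f g, cancel g f & continuous g].

Definition local_homeomorphism (Y X : topologicalType) (p : Y -> X) : Prop :=
  forall y : Y, exists U : set Y,
    [/\ open U, U y, open (p @` U), {within U, continuous p}
      & exists2 g : X -> Y,
          {in U, cancel p g} & {within p @` U, continuous g}].

Section Semicovering.
Context {Y X : topologicalType} (p : continuousType Y X).

Section PostComposition.
Context {Z : topologicalType} (z : Z) (y : Y).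

Lemma post_comp_subproof (f : pointed_maps z y) :
  (p \o (\val f : Z -> Y)) \in pointed_maps z (p y).
Proof.
have [cf fz] := set_mem (valP f).
apply/mem_set; split; last by rewrite /= fz.
by move=> t; apply: continuous_comp; [exact: cf|exact: cts_fun].
Qed.

Definition post_comp (f : pointed_maps z y) : pointed_maps z (p y) :=
  exist (fun h => h \in pointed_maps z (p y)) _ (post_comp_subproof f).

End PostComposition.

Arguments post_comp {Z} z y f.

Definition continuous_path_lifting (R : realType) : Prop :=
  forall y : Y,
    homeomorphism (post_comp zero y : path_space R y -> path_space R (p y)).

Definition continuous_homotopy_lifting (R : realType) : Prop :=
  forall y : Y,
    homeomorphism (post_comp (disk_base R) y : disk_space R y -> disk_space R (p y)).

Definition semicovering (R : realType) : Prop :=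
  [/\ local_homeomorphism p, continuous_path_lifting R
    & continuous_homotopy_lifting R].

End Semicovering.

Definition path_connected (R : realType) (X : topologicalType) (A : set X) :
    Prop :=
  forall a b, A a -> A b ->
    exists f : {path (unit_interval R) from a to b in X}, range f `<=` A.

Definition locally_path_connected (R : realType) (X : topologicalType) : Prop :=
  forall (x : X) (U : set X), nbhs x U ->
    exists W : set X, [/\ open W, W x, W `<=` U & path_connected R W].

Section PathSpanier.
Context {R : realType} {X : topologicalType} {x : X}.
Local Notation I := (unit_interval R).

Definition endpoint (u : path_space R x) : X := (\val u : I -> X) one.

Lemma path_of_continuous (u : path_space R x) : continuous (\val u : I -> X).
Proof. by have [] := set_mem (valP u). Qed.

Lemma path_of0 (u : path_space R x) : (\val u : I -> X) zero = x.
Proof. by have [] := set_mem (valP u). Qed.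

Definition path_of (u : path_space R x) :
    {path I from x to (endpoint u) in X} :=
  mk_path (@path_of_continuous u) (path_of0 u) (erefl (endpoint u)).

Definition path_open_cover (V : path_space R x -> set X) : Prop :=
  [/\ forall u, open (V u), \bigcup_u V u = [set: X]
    & forall u, V u (endpoint u)].

Definition path_spanier (V : path_space R x -> set X) : set (pi1 R x) :=
  [set a | exists (n : nat) (u : 'I_n -> path_space R x)
      (v : forall j,
         {path I from (endpoint (u j)) to (endpoint (u j)) in X}),
    (forall j, range (v j) `<=` V (u j)) /\
    a = (\big[*%g/1%g]_(j < n)
          loop_class (concat (concat (path_of (u j)) (v j))
                             (reverse (path_of (u j)))))].

End PathSpanier.

(* Main.v *)
Require Import Defs.
From HB Require Import structures.
From Corelib Require Setoid Morphisms.
From mathcomp Require Import all_boot all_order all_algebra generic_quotient.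
From mathcomp Require Import ring lra.
From mathcomp Require Import all_classical all_reals topology normedtype.
From mathcomp Require Import homotopy.

(* Given a semicovering, lift each path u at the base point and let V u be the
   image of a chart around the endpoint of the lift: loops in V u based at u(1)
   lift to loops in the chart, so each lasso lifts to a loop. Conversely, take
   the set of paths from x modulo u ~ v iff [u v^-1] is in H, with the whisker
   topology. Since lassos u v u^-1 with v in V u lie in H, whiskers at [u]
   inside V u are determined by their endpoints, which makes the endpoint
   projection a local homeomorphism, and a path f lifts to t |-> [u f|[0,t]].
   This lift is jointly continuous in (f, t): continuity at one time spreads to
   all times of a chart, hence to the connected interval. Currying gives
   continuous path lifting, and maps of the disk are lifted along the segments
   issued from its base point, so homotopy lifting follows from path lifting. *)

Set Implicit Arguments.
Unset Strict Implicit.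
Unset Printing Implicit Defensive.
Import Order.TTheory GRing.Theory Num.Theory.
Import numFieldNormedType.Exports.

Local Open Scope classical_set_scope.
Local Open Scope ring_scope.

(** * Topological preliminaries *)

Lemma set_type_compact (T : topologicalType) (A : set T) :
  compact A -> compact [set: A].
Proof.
move=> cA F FF _.
have [|p [Ap clp]] := cA (set_val @ F) (fmap_proper_filter _ FF).
  suff -> : (set_val @ F) A = F setT by exact: filterT.
  congr F; apply/seteqP; split=> // a _ /=.
  by rewrite set_valE; exact: set_mem (valP a).
exists (exist (fun a => a \in A) p (mem_set Ap)).
split=> // B C FB [D [[W oW <-] Wp WC]].
have FB' : (set_val @ F) (set_val @` B).
  by apply: (@filterS _ F _ B) => // b Bb; exists b.
have [_ [[b Bb <-] Wb]] := clp _ _ FB' (open_nbhs_nbhs (conj oW Wp)).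
by exists b; split=> //; exact: WC.
Qed.

Lemma pairl_continuous (T U : topologicalType) (t : T) :
  continuous (fun u : U => (t, u)).
Proof.
apply: (@pair_continuous _ _ _ (cst t) id); first exact: cst_continuous.
by move=> u; exact: cvg_id.
Qed.

Lemma pairr_continuous (T U : topologicalType) (u : U) :
  continuous (fun t : T => (t, u)).
Proof.
apply: (@pair_continuous _ _ _ id (cst u)); last exact: cst_continuous.
by move=> t; exact: cvg_id.
Qed.

(** The condition on [J] is symmetric in [s] and [u], so [S] and its complement are both open. This
    serves to continue lifts along the interval without subdividing it. *)
Lemma connected_locally_constant (T : topologicalType) (S : set T) :
  connected [set: T] ->
  S !=set0 ->
  (forall t : T, exists2 J : set T,
     nbhs t J & forall s u, J s -> J u -> S s -> S u) ->
  S = setT.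
Proof.
move=> cT S0 loc; apply: cT => //; exists S; rewrite ?setTI //.
- rewrite openE => t St; have [J tJ JS] := loc t.
  apply: filterS (tJ) => u Ju; exact: JS (nbhs_singleton tJ) Ju St.
- rewrite -openC openE => t St; have [J tJ JS] := loc t.
  apply: filterS (tJ) => u Ju Su; apply: St.
  exact: JS Ju (nbhs_singleton tJ) Su.
Qed.

(** * Compactness, regularity and connectedness of the interval and the disk *)

Section IntervalAndDisk.
Context {R : realType}.
Local Notation I := (unit_interval R).

Lemma unit_interval_compact : compact [set: I].
Proof. exact: (set_type_compact (@segment_compact R 0 1)). Qed.

Lemma unit_interval_regular : regular_space I.
Proof. exact: (@uniform_regular (set_type `[0 : R, 1]%classic)). Qed.

Lemma unit_interval_locally_compact : locally_compact [set: I].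
Proof.
move=> t _; rewrite withinET; exists setT; first exact: filterT.
by split; [exact: unit_interval_compact | exact: closedT].
Qed.

Lemma closed_disk_compact : compact (closed_disk R).
Proof.
have cf : continuous (fun z : R * R => z.1 ^+ 2 + z.2 ^+ 2 : R).
  move=> z; apply: (@continuousD _ R^o _ (fun z : R * R => z.1 ^+ 2 : R)
    (fun z : R * R => z.2 ^+ 2 : R)).
    by apply: (@continuousM _ _ fst fst); exact: cvg_fst.
  by apply: (@continuousM _ _ snd snd); exact: cvg_snd.
have clD : closed (closed_disk R).
  have -> : closed_disk R = (fun z : R * R => z.1 ^+ 2 + z.2 ^+ 2 : R)
    @^-1` [set r | r <= 1] by [].
  by apply: preimage_closed => //; exact: closed_le.
apply: (subclosed_compact clD (compact_setX (@segment_compact R (-1) 1)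
  (@segment_compact R (-1) 1))).
move=> [a b]; rewrite /closed_disk /= !in_itv /= => ab.
by have := sqr_ge0 a; have := sqr_ge0 b; split; apply/andP; split; nra.
Qed.

Lemma disk_locally_compact : locally_compact [set: closed_disk R].
Proof.
move=> t _; rewrite withinET; exists setT; first exact: filterT.
by split; [exact: set_type_compact closed_disk_compact | exact: closedT].
Qed.

Lemma disk_regular : regular_space (closed_disk R).
Proof. exact: uniform_regular. Qed.

Lemma unit_interval_connected : connected [set: I].
Proof.
have -> : [set: I] = clamp @` `[0 : R, 1]%classic.
  apply/seteqP; split=> // t _; exists (ival t); last exact: clamp_ival.
  by rewrite /= in_itv /= ival_itv.
apply: connected_continuous_connected; first exact: segment_connected.
apply: continuous_subspaceT; exact: clamp_continuous.
Qed.

Lemma ball_ival_open (t : I) (e : R) : open [set s : I | `|ival s - ival t| < e].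
Proof.
have -> : [set s : I | `|ival s - ival t| < e] = ival @^-1` ball (ival t) e.
  by apply/seteqP; split=> s; rewrite /ball /= distrC.
by apply: open_comp; [move=> s _; exact: ival_continuous | exact: ball_open].
Qed.

Lemma nbhs_ivalP (t : I) (A : set I) : nbhs t A ->
  exists2 e : R, 0 < e & [set s | `|ival s - ival t| < e] `<=` A.
Proof.
move=> tA; have := @clamp_continuous R (ival t) A.
rewrite clamp_ival => /(_ tA) /nbhs_ballP[e /= e0 eA]; exists e => // s /= st.
by rewrite -(clamp_ival s); apply: eA; rewrite /ball /= distrC.
Qed.

End IntervalAndDisk.

(** * Evaluation and currying for spaces of pointed maps *)

Section PointedMaps.
Context {Z Y : topologicalType} (z : Z) (y : Y).
Hypothesis lcZ : locally_compact [set: Z].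
Hypothesis regZ : regular_space Z.

(** Local compactness and regularity of [Z] allow uncurrying of the continuous inclusion into the
    compact-open mapping space. *)
Lemma pointed_eval_continuous :
  continuous (fun fz : pointed_maps z y * Z => (\val fz.1 : Z -> Y) fz.2).
Proof.
rewrite (_ : (fun fz : _ * Z => _) =
  uncurry (fun f : pointed_maps z y => (\val f : Z -> Y))); last first.
  by apply/funext => -[].
apply: (continuous_uncurry_regular lcZ regZ).
  exact: initial_continuous.
by move=> f; have [] := set_mem (valP f).
Qed.

Lemma pointed_maps_continuous (T : topologicalType) (F : T -> pointed_maps z y) :
  continuous (fun tz : T * Z => (\val (F tz.1) : Z -> Y) tz.2) -> continuous F.
Proof.
move=> cF; apply: continuous_comp_initial.
exact: (continuous_curry_fun cF).
Qed.

End PointedMaps.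

(** * Segments from the base point of the disk *)

Section Ray.
Context {R : realType}.
Local Notation I := (unit_interval R).
Local Notation D := (closed_disk R).

Lemma ray_subproof (d : D) (t : I) :
  (1 + ival t * ((\val d).1 - 1), ival t * (\val d).2) \in closed_disk R.
Proof.
apply/mem_set; have := set_mem (valP d); case: (\val d) => a b.
rewrite /closed_disk /= => ab; have /andP[] := ival_itv t.
move: (ival t) => r r0 r1.
have a1 : a <= 1 by have := sqr_ge0 b; nra.
(* The squared norm is $(1-r)^2 + 2r(1-r)a + r^2(a^2+b^2)$; this bound and the next one bring it
   below $((1-r)+r)^2 = 1$. *)
have r2ab : r ^+ 2 * (a ^+ 2 + b ^+ 2) <= r ^+ 2 by rewrite ler_piMr ?sqr_ge0.
have rra : (r * (1 - r)) * a <= r * (1 - r).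
  by rewrite ler_piMr // mulr_ge0 // subr_ge0.
nra.
Qed.

Definition ray (d : D) (t : I) : D :=
  exist (fun z => z \in closed_disk R) _ (ray_subproof d t).

Lemma ray0 d : ray d zero = disk_base R.
Proof. by apply: val_inj; rewrite /= ival0 !mul0r addr0. Qed.

Lemma ray1 d : ray d one = d.
Proof.
apply: val_inj; rewrite /= ival1 !mul1r addrC subrK.
by rewrite -surjective_pairing.
Qed.

Lemma ray_base t : ray (disk_base R) t = disk_base R.
Proof. by apply: val_inj; rewrite /= subrr !mulr0 addr0. Qed.

Lemma ray_continuous : continuous (fun dt : D * I => ray dt.1 dt.2).
Proof.
have cD : continuous (fun dt : D * I => set_val dt.1 : R * R).
  move=> dt; apply: (@continuous_comp _ _ _ fst (set_val : D -> R * R)).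
    exact: cvg_fst.
  exact: initial_continuous.
have cI : continuous (fun dt : D * I => ival dt.2).
  move=> dt; apply: (@continuous_comp _ _ _ snd ival); first exact: cvg_snd.
  exact: ival_continuous.
apply: continuous_comp_initial.
apply: (@pair_continuous _ _ _
  (fun dt : D * I => 1 + ival dt.2 * ((set_val dt.1).1 - 1) : R)
  (fun dt : D * I => ival dt.2 * (set_val dt.1).2 : R)) => dt.
  apply: (@continuousD _ R^o _ (cst 1) (fun dt : D * I =>
    ival dt.2 * ((set_val dt.1).1 - 1) : R)); first exact: cvg_cst.
  apply: (@continuousM _ _ (fun dt : D * I => ival dt.2)
    (fun dt : D * I => (set_val dt.1).1 - 1 : R)); first exact: cI.
  apply: (@continuousB _ R^o _ (fun dt : D * I => (set_val dt.1).1 : R) (cst 1)).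
    apply: (@continuous_comp _ _ _ (fun dt : D * I => set_val dt.1 : R * R) fst).
      exact: cD.
    exact: cvg_fst.
  exact: cvg_cst.
apply: (@continuousM _ _ (fun dt : D * I => ival dt.2)
  (fun dt : D * I => (set_val dt.1).2 : R)); first exact: cI.
apply: (@continuous_comp _ _ _ (fun dt : D * I => set_val dt.1 : R * R) snd).
  exact: cD.
exact: cvg_snd.
Qed.

End Ray.

(** * Path lifting implies homotopy lifting *)

Section HomotopyLifting.
Context {R : realType} {Y X : topologicalType} (p : continuousType Y X).
Local Notation I := (unit_interval R).
Local Notation D := (closed_disk R).

Lemma post_comp_continuous (Z : topologicalType) (z : Z) (y : Y) :
  locally_compact [set: Z] -> regular_space Z ->
  continuous (@post_comp Y X p Z z y).
Proof.
move=> lcZ regZ; apply: pointed_maps_continuous => fz.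
apply: (@continuous_comp _ _ _
  (fun fz : pointed_maps z y * Z => (\val fz.1 : Z -> Y) fz.2) p).
  exact: pointed_eval_continuous.
exact: cts_fun.
Qed.

Section AlongRays.
Context {W : topologicalType} (w : W).

Lemma along_ray_subproof (f : disk_space R w) (d : D) :
  (\val f : D -> W) \o ray d \in pointed_maps (zero : I) w.
Proof.
have [cf fw] := set_mem (valP f).
apply/mem_set; split; last by rewrite /= ray0.
move=> t; apply: (@continuous_comp _ _ _ (ray d) (\val f : D -> W)); last first.
  exact: cf.
apply: (@continuous_comp _ _ _ (fun t => (d, t)) (fun dt => ray dt.1 dt.2)).
  exact: pairl_continuous.
exact: ray_continuous.
Qed.

Definition along_ray (f : disk_space R w) (d : D) : path_space R w :=
  exist (fun h => h \in pointed_maps (zero : I) w) _ (along_ray_subproof f d).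

Lemma along_ray_continuous :
  continuous (fun fd : disk_space R w * D => along_ray fd.1 fd.2).
Proof.
apply: pointed_maps_continuous => u.
apply: (@continuous_comp _ _ _
  (fun u : disk_space R w * D * I => (u.1.1, ray u.1.2 u.2))
  (fun fz : disk_space R w * D => (\val fz.1 : D -> W) fz.2)); last first.
  apply: pointed_eval_continuous.
    exact: disk_locally_compact.
  exact: disk_regular.
apply: (@pair_continuous _ _ _ (fun u : disk_space R w * D * I => u.1.1)
  (fun u : disk_space R w * D * I => ray u.1.2 u.2)) => {}u.
  by apply: continuous_comp; exact: cvg_fst.
apply: (@continuous_comp _ _ _ (fun u : disk_space R w * D * I => (u.1.2, u.2))
  (fun dt => ray dt.1 dt.2)); last exact: ray_continuous.
apply: (@pair_continuous _ _ _ (fun u : disk_space R w * D * I => u.1.2) snd).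
  move=> {}u; apply: (@continuous_comp _ _ _ fst snd).
    exact: cvg_fst.
  exact: cvg_snd.
exact: snd_continuous.
Qed.

End AlongRays.

Lemma path_lifting_homotopy_lifting :
  continuous_path_lifting p R -> continuous_homotopy_lifting p R.
Proof.
move=> plift y; split.
  by apply: post_comp_continuous; [exact: disk_locally_compact|exact: disk_regular].
have [_ [L [KL LK cL]]] := plift y.
have LE u t : p ((\val (L u) : I -> Y) t) = (\val u : I -> X) t.
  by rewrite -{2}(LK u).
(* The candidate lift at [d] is the end of the lifted path over the segment from the base point to
   [d]. *)
pose M (f : disk_space R (p y)) (d : D) := endpoint (L (along_ray f d)).
have cM : continuous (fun fd : disk_space R (p y) * D => M fd.1 fd.2).
  move=> fd; apply: (@continuous_comp _ _ _
    (fun fd : disk_space R (p y) * D => L (along_ray fd.1 fd.2)) endpoint).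
    apply: (@continuous_comp _ _ _
      (fun fd : disk_space R (p y) * D => along_ray fd.1 fd.2) L).
      exact: along_ray_continuous.
    exact: cL.
  apply: (@continuous_comp _ _ _ (fun u : path_space R y => (u, one : I))
    (fun fz : path_space R y * I => (\val fz.1 : I -> Y) fz.2)).
    exact: pairr_continuous.
  apply: pointed_eval_continuous.
    exact: unit_interval_locally_compact.
  exact: unit_interval_regular.
have Lval (u : path_space R (p y)) (v : path_space R y) :
    (\val u : I -> X) = p \o (\val v : I -> Y) -> L u = v.
  by move=> uv; rewrite -(KL v); congr L; exact: val_inj.
have MP f : M f \in pointed_maps (disk_base R) y.
  apply/mem_set; split.
    move=> d; apply: (@continuous_comp _ _ _ (fun d => (f, d))
      (fun fd : disk_space R (p y) * D => M fd.1 fd.2)); last exact: cM.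
    exact: pairl_continuous.
  (* The ray to the base point is constant, so its lift is the constant path at [y] and [M f] is
     based. *)
  have cstP : cst y \in pointed_maps (zero : I) y.
    by apply/mem_set; split=> //; exact: cst_continuous.
  rewrite /M (Lval _ (exist (fun h => h \in pointed_maps (zero : I) y) _ cstP)) //.
  apply/funext => t /=; rewrite ray_base.
  by have [] := set_mem (valP f).
pose N f : disk_space R y :=
  exist (fun h => h \in pointed_maps (disk_base R) y) _ (MP f).
exists N; split.
- move=> f; apply: val_inj; apply/funext => d /=.
  rewrite /M (Lval _ (along_ray f d)) //.
  by rewrite /endpoint /= ray1.
- move=> f; apply: val_inj; apply/funext => d /=.
  by rewrite /M LE /= ray1.
- exact: pointed_maps_continuous.
Qed.

End HomotopyLifting.

(** * Calculus of paths up to homotopy *)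

Section Groupoid.
Context {R : realType} {X : topologicalType}.
Local Notation I := (unit_interval R).

(** With this instance and the next one, [rewrite] works modulo homotopy, including inside
    [concat]. *)
#[global] Instance path_homotopic_equivalence (x y : X) :
  RelationClasses.Equivalence (@path_homotopic R X x y).
Proof.
split.
- exact: path_homotopic_refl.
- exact: path_homotopic_sym.
- exact: path_homotopic_trans.
Qed.

#[global] Instance concat_proper (x y z : X) :
  Morphisms.Proper (Morphisms.respectful (@path_homotopic R X x y)
    (Morphisms.respectful (@path_homotopic R X y z) (@path_homotopic R X x z)))
    (@concat R X x y z).
Proof. by move=> f f' ff' g g' gg'; exact: path_homotopic_concat. Qed.

Lemma reverse_concat (x y z : X) (f : {path I from x to y in X})
    (g : {path I from y to z in X}) :
  reverse (concat f g) = concat (reverse g) (reverse f).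
Proof.
apply/path_eqP => t; have /andP[t0 t1] := ival_itv t.
rewrite -[LHS]/(concat f g (clamp (1 - ival t))).
have rI : ival (clamp (1 - ival t)) = 1 - ival t by rewrite clampE //; lra.
case: (ltgtP (ival t) 2^-1) => t2.
- rewrite [LHS]concatEr ?[RHS]concatEl ?rI; [|lra..].
  rewrite -[RHS]/(g (clamp (1 - _))) clampE; last by apply/andP; lra.
  by congr (g (clamp _)); lra.
- rewrite [LHS]concatEl ?[RHS]concatEr ?rI; [|lra..].
  rewrite -[RHS]/(f (clamp (1 - _))) clampE; last by apply/andP; lra.
  by congr (f (clamp _)); lra.
(* At the midpoint [concat] uses its first factor, which is [f] on the left and [reverse g] on the
   right; both values are [y]. *)
- rewrite [LHS]concatEl ?[RHS]concatEl ?rI; [|lra..].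
  rewrite -[RHS]/(g (clamp (1 - _))) t2.
  have -> : 2 * (1 - 2^-1) = 1 :> R by field.
  have -> : 2 * 2^-1 = 1 :> R by field.
  by rewrite clamp1 ival1 subrr clamp0 path_one path_zero.
Qed.

Lemma reverse_involutive (x y : X) (f : {path I from x to y in X}) :
  reverse (reverse f) = f.
Proof. by apply/path_eqP; exact: reverseK. Qed.

Lemma concatK (x y z : X) (f : {path I from x to y in X})
    (g : {path I from y to z in X}) :
  path_homotopic (concat (concat f g) (reverse g)) f.
Proof.
rewrite -concatA concat_reverser concat_constr.
exact: path_homotopic_refl.
Qed.

Lemma concatVK (x y z : X) (f : {path I from x to y in X})
    (g : {path I from z to y in X}) :
  path_homotopic (concat (concat f (reverse g)) g) f.
Proof.
rewrite -concatA concat_reversel concat_constr.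
exact: path_homotopic_refl.
Qed.

Lemma path_connectedT : connected [set: X] -> locally_path_connected R X ->
  forall a b : X, exists f : {path I from a to b in X}, True.
Proof.
move=> cX lpcX a b.
suff : [set b : X | exists f : {path I from a to b in X}, True] = setT.
  by move/seteqP => -[_ /(_ b)]; exact.
apply: connected_locally_constant => //; first by exists a, (const_path a).
move=> c; have [W [oW Wc _ pW]] := lpcX c setT filterT.
exists W; first exact: open_nbhs_nbhs.
move=> s u Ws Wu [f _]; have [g _] := pW _ _ Ws Wu.
by exists (concat f g).
Qed.

Lemma range_concat (x y z : X) (f : {path I from x to y in X})
    (g : {path I from y to z in X}) (U : set X) :
  range f `<=` U -> range g `<=` U -> range (concat f g) `<=` U.
Proof.
move=> fU gU _ [t _ <-]; rewrite /concat /= /mk_path /concat_fun.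
by case: ifP => _; [apply: fU | apply: gU]; eexists.
Qed.

Lemma range_reverse (x y : X) (f : {path I from x to y in X}) (U : set X) :
  range f `<=` U -> range (reverse f) `<=` U.
Proof. by move=> fU _ [t _ <-]; apply: fU; eexists. Qed.

Lemma range_const_path (x : X) (U : set X) :
  U x -> range (const_path (R := R) x) `<=` U.
Proof. by move=> Ux _ [t _ <-]. Qed.

End Groupoid.

(** * From a semicovering to a path open cover *)

Section Spanier.
Context {R : realType} {Y X : topologicalType} (p : continuousType Y X).
Local Notation I := (unit_interval R).

(** The local inverse [g] is single-valued, so it turns the loop [v] into a loop at the endpoint of
    [u]; conjugating by [u] gives a loop whose image is the given lasso. *)
Lemma lasso_lift (y : Y) (u : path_space R y) (U : set Y) (g : X -> Y)
    (v : {path I from endpoint (post_comp p u) to endpoint (post_comp p u) in X}) :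
  U (endpoint u) -> {in U, cancel p g} -> {within p @` U, continuous g} ->
  range v `<=` p @` U ->
  range (pi1_map (R := R) (erefl (p y)))
    (loop_class (concat (concat (path_of (post_comp p u)) v)
                        (reverse (path_of (post_comp p u))))).
Proof.
move=> Uu pK cg vU.
have gvc : continuous (g \o v).
  move/subspace_continuousP: cg => cg t O gvtO.
  have vt : (p @` U) (v t) by apply: vU; exists t.
  have := @cts_fun _ _ v t _ (cg _ vt O gvtO); rewrite /= !nbhs_simpl /=.
  by apply: filterS => s; apply; apply: vU; exists s.
have gv0 : g (endpoint (post_comp p u)) = endpoint u.
  by rewrite -[endpoint (post_comp p u)]/(p (endpoint u)) pK //; exact/mem_set.
have gv_zero : (g \o v) zero = endpoint u by rewrite /= path_zero.
have gv_one : (g \o v) one = endpoint u by rewrite /= path_one.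
pose w : {path I from endpoint u to endpoint u in Y} :=
  mk_path gvc gv_zero gv_one.
exists (loop_class (concat (concat (path_of u) w) (reverse (path_of u)))) => //.
rewrite pi1_mapE; congr loop_class; apply/path_eqP => t.
have pgv s : p (g (v s)) = v s.
  have [|b Ub bv] := vU (v s); first by exists s.
  by rewrite -bv pK //; exact/mem_set.
rewrite /= /mk_path /concat_fun /= /mk_path /concat_fun.
case: ifP => _ //=; case: ifP => _ //=.
by rewrite /mk_path pgv.
Qed.

Lemma semicovering_spanier (y : Y) : connected [set: X] ->
  locally_path_connected R X -> semicovering p R ->
  group_closed (mem (range (pi1_map (R := R) (erefl (p y))))) ->
  exists V : path_space R (p y) -> set X,
    path_open_cover V /\
    path_spanier V `<=` range (pi1_map (R := R) (erefl (p y))).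
Proof.
move=> cX lpcX [loc plift _] grp.
have [_ [L [KL LK _]]] := plift y.
have /choice[U UP] := loc.
exists (fun u => p @` U (endpoint (L u))); split; first split.
- by move=> u; have [] := UP (endpoint (L u)).
- apply/seteqP; split=> // z _; have [f _] := path_connectedT cX lpcX (p y) z.
  have fP : (f : I -> X) \in pointed_maps (zero : I) (p y).
    by apply/mem_set; split; [exact: cts_fun | exact: path_zero].
  pose u : path_space R (p y) :=
    exist (fun h => h \in pointed_maps (zero : I) (p y)) _ fP.
  exists u => //; exists (endpoint (L u)).
    by have [] := UP (endpoint (L u)).
  rewrite -[LHS]/(endpoint (post_comp p (L u))) LK.
  by rewrite /endpoint /= path_one.
- move=> u; exists (endpoint (L u)); first by have [] := UP (endpoint (L u)).
  by rewrite -[LHS]/(endpoint (post_comp p (L u))) LK.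
- move=> _ [n [u [v [vU ->]]]].
  elim/big_ind: _ => [|a b aH bH|j _].
  + by have [+ _] := grp; rewrite -topredE /= => /set_mem.
  + by apply/set_mem; apply: (group_closedM grp); exact/mem_set.
  (* Writing [u] as the projection of its lift puts the lasso in the form that [lasso_lift] handles;
     [v] is generalized too because its type depends on [u]. *)
  + move: (u j) (v j) (vU j) => {u v vU} u.
    rewrite -(LK u) => v; rewrite KL.
    have [oU Uu opU _ [g pK cg]] := UP (endpoint (L u)).
    exact: (lasso_lift Uu pK cg).
Qed.

End Spanier.

(** * Open, locally injective maps *)

Section OpenLocallyInjective.
Context {Y X : topologicalType} (p : Y -> X).

Lemma open_injective_local_homeomorphism : continuous p ->
  (forall O, open O -> open (p @` O)) ->
  (forall y, exists2 B : set Y, open_nbhs y B & {in B &, injective p}) ->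
  local_homeomorphism p.
Proof.
move=> cp op inj y; have [B [oB By] pB] := inj y; exists B; split=> //.
- exact: op.
- exact: continuous_subspaceT.
(* [g] picks the preimage in [B]; [y] is only the default value outside the image of [B]. *)
pose g w := xget y (B `&` p @^-1` [set w]).
have gK : {in B, cancel p g}.
  move=> b /set_mem Bb; have [Bg pg] : (B `&` p @^-1` [set p b]) (g (p b)).
    by apply: (@xgetPex _ y _); exists b.
  by apply: pB => //; exact/mem_set.
exists g => //; apply/subspace_continuousP => _ [b Bb <-] O.
rewrite /= /from_subspace gK; last exact/mem_set.
rewrite nbhsE => -[O' [oO' O'b] O'O].
(* Openness of [p] makes the inverse continuous: on this neighbourhood [g] takes its values in
   [O']. *)
have : nbhs (p b) (p @` (O' `&` B)).
  by apply: open_nbhs_nbhs; split; [exact/op/openI | exists b].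
apply: filterS => _ [c [O'c Bc] <-] _; apply: O'O.
by rewrite /= gK //; exact/mem_set.
Qed.

End OpenLocallyInjective.

(** * Segments and subpaths *)

Section Segment.
Context {R : realType}.
Local Notation I := (unit_interval R).

(** Either order of [s] and [t] is allowed, since lifts are continued in both directions of time; if
    [t] comes first, the interval is run backwards. *)
Definition segment_fun (s t r : I) : I :=
  clamp ((ival t - ival s) * ival r + ival s).

Lemma segment_fun0 s t : segment_fun s t zero = s.
Proof. by rewrite /segment_fun ival0 mulr0 add0r clamp_ival. Qed.

Lemma segment_fun1 s t : segment_fun s t one = t.
Proof. by rewrite /segment_fun ival1 mulr1 subrK clamp_ival. Qed.

Definition segment (s t : I) : {path I from s to t in I} :=
  mk_path (@ival_affine_continuous R (ival t - ival s) (ival s))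
    (segment_fun0 s t) (segment_fun1 s t).

Lemma segment_ball (c s t r : I) (e : R) :
  `|ival s - ival c| < e -> `|ival t - ival c| < e ->
  `|ival (segment s t r) - ival c| < e.
Proof.
have /andP[r0 r1] := ival_itv r; have /andP[s0 s1] := ival_itv s.
have /andP[t0 t1] := ival_itv t.
(* Convexity of the ball, applied below to the distances of [s] and [t] from either end of it. *)
have pos (A B : R) : 0 < A -> 0 < B -> 0 < (1 - ival r) * A + ival r * B.
  move=> A0 B0; move: r0; rewrite le_eqVlt => /orP[/eqP <-|r0]; first lra.
  by rewrite ltr_wpDl ?mulr_gt0 // mulr_ge0 ?subr_ge0 // ltW.
rewrite !ltr_norml => /andP[sl su] /andP[tl tu].
rewrite -[segment s t r]/(clamp _) clampE; last by apply/andP; split; nra.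
have P1 : 0 < ival s - ival c + e by lra.
have P2 : 0 < ival t - ival c + e by lra.
have P3 : 0 < e - (ival s - ival c) by lra.
have P4 : 0 < e - (ival t - ival c) by lra.
have Q1 := pos _ _ P1 P2; have Q2 := pos _ _ P3 P4.
by apply/andP; split; lra.
Qed.

Context {X : topologicalType} (f : I -> X) (cf : continuous f).

Section Subpath.
Context (s t : I) (a b : X) (fs : f s = a) (ft : f t = b).

Lemma subpath_continuous : continuous (f \o segment s t).
Proof.
by move=> r; apply: continuous_comp; [exact: cts_fun | exact: cf].
Qed.

Lemma subpath_zero : (f \o segment s t) zero = a.
Proof. by rewrite /= path_zero. Qed.

Lemma subpath_one : (f \o segment s t) one = b.
Proof. by rewrite /= path_one. Qed.

(** Endpoints are prescribed through equations, so that subpaths can be concatenated with other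
    paths without transport. *)
Definition subpath : {path I from a to b in X} :=
  mk_path subpath_continuous subpath_zero subpath_one.

End Subpath.

(** Both sides are [f] composed with paths in the interval having the same ends, hence homotopic by
    reparametrization, whatever the order of [r], [s] and [t]. *)
Lemma subpath_concat (r s t : I) (a b c : X) (fr : f r = a) (fs : f s = b)
    (ft : f t = c) :
  path_homotopic (concat (subpath fr fs) (subpath fs ft)) (subpath fr ft).
Proof.
apply: (@homotopic_reparam _ _ f (concat (segment r s) (segment s t))
  (segment r t)) => //.
- exact: cts_fun.
- exact: cts_fun.
- by rewrite !path_zero.
- by rewrite !path_one.
- move=> u; rewrite /concat /= /mk_path /concat_fun /=.
  by case: ifP.
Qed.

End Segment.

(** * Cosets of paths and the whisker topology *)

Section CosetCover.
Context {R : realType} {X : topologicalType} {x : X} (H : set (pi1 R x)).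
Local Notation I := (unit_interval R).

Definition same_coset z (a b : {path I from x to z in X}) : Prop :=
  H (loop_class (concat a (reverse b))).

(** A point carries an entire class of paths, so that equality over a given endpoint is equality of
    sets; the endpoint is a field since the type of the paths depends on it. *)
Record coset_cover : Type := CosetCover {
  cover_proj : X;
  cover_coset : set {path I from x to cover_proj in X};
  cover_cosetP : exists a, cover_coset = same_coset a }.

HB.instance Definition _ := gen_eqMixin coset_cover.
HB.instance Definition _ := gen_choiceMixin coset_cover.

Definition coset_of_path z (a : {path I from x to z in X}) : coset_cover :=
  CosetCover (ex_intro _ a erefl).

(* The whisker topology, with the condition imposed on every path
   representing a point, so that no choice of representatives is involved. *)
Definition cover_open (O : set coset_cover) : Prop :=
  forall z (a : {path I from x to z in X}), O (coset_of_path a) ->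
  exists U : set X, [/\ open U, U z & forall w (d : {path I from z to w in X}),
    range d `<=` U -> O (coset_of_path (concat a d))].

Lemma cover_openT : cover_open setT.
Proof. by move=> z a _; exists setT; split=> //; exact: openT. Qed.

Lemma cover_openI : setI_closed cover_open.
Proof.
move=> O P oO oP z a [/oO[U [oU Uz UO]] /oP[V [oV Vz VP]]].
exists (U `&` V); split=> //; first exact: openI.
by move=> w d; rewrite subsetI => -[dU dV]; split; [exact: UO | exact: VP].
Qed.

Lemma cover_open_bigU (J : Type) (F : J -> set coset_cover) :
  (forall j, cover_open (F j)) -> cover_open (\bigcup_j F j).
Proof.
move=> oF z a [j _ /oF[U [oU Uz UF]]]; exists U; split=> // w d dU.
by exists j => //; exact: UF.
Qed.

HB.instance Definition _ :=
  isOpenTopological.Build coset_cover cover_openT cover_openI cover_open_bigU.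

Lemma cover_openE (O : set coset_cover) : open O = cover_open O.
Proof. by []. Qed.

Lemma coset_cover_eq z (A B : set {path I from x to z in X}) AP BP :
  A = B -> @CosetCover z A AP = @CosetCover z B BP.
Proof. by move=> AB; subst B; congr CosetCover; exact: Prop_irrelevance. Qed.

Lemma coset_cover_ind (P : coset_cover -> Prop) :
  (forall z (a : {path I from x to z in X}), P (coset_of_path a)) ->
  forall y, P y.
Proof.
move=> Pa [z A AP]; have [a Aa] := AP.
by have := Pa z a; congr P; exact: coset_cover_eq.
Qed.

Lemma cover_proj_continuous : continuous cover_proj.
Proof.
apply/continuousP => U oU; rewrite cover_openE => z a /= Uz.
exists U; split=> // w d dU /=.
by apply: dU; exists one => //; exact: path_one.
Qed.

HB.instance Definition _ :=
  isContinuous.Build coset_cover X cover_proj cover_proj_continuous.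

Hypothesis grp_H : group_closed (mem H).

Let H1 : H 1%g.
Proof. by have [+ _] := grp_H; rewrite -topredE /= => /set_mem. Qed.

Let HM g h : H g -> H h -> H (g * h)%g.
Proof.
by move=> Hg Hh; apply/set_mem; apply: (group_closedM grp_H); exact/mem_set.
Qed.

Let HV g : H g -> H (g^-1)%g.
Proof.
by move=> Hg; apply/set_mem; apply: (group_closedV grp_H); exact/mem_set.
Qed.

Lemma homotopic_same_coset z (a b : {path I from x to z in X}) :
  path_homotopic a b -> same_coset a b.
Proof.
move=> ab; rewrite /same_coset (_ : loop_class _ = 1%g); first exact: H1.
rewrite -loop_class_const; apply/loop_classP.
by rewrite ab concat_reverser; exact: path_homotopic_refl.
Qed.

Lemma same_coset_sym z (a b : {path I from x to z in X}) :
  same_coset a b -> same_coset b a.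
Proof.
move=> /HV; rewrite -loop_class_reverse reverse_concat.
by rewrite reverse_involutive.
Qed.

Lemma same_coset_trans z (a b c : {path I from x to z in X}) :
  same_coset a b -> same_coset b c -> same_coset a c.
Proof.
move=> ab bc; have := HM ab bc; rewrite -loop_class_concat /same_coset.
congr H; apply/loop_classP.
by rewrite concatA concatVK; exact: path_homotopic_refl.
Qed.

Lemma same_coset_concat z w (a b : {path I from x to z in X})
    (d : {path I from z to w in X}) :
  same_coset a b -> same_coset (concat a d) (concat b d).
Proof.
rewrite /same_coset; congr H; apply/loop_classP.
by rewrite reverse_concat concatA concatK; exact: path_homotopic_refl.
Qed.

(** The loop $(ad)(ae)^{-1}$ is homotopic to the lasso with tail $a$ and head $de^{-1}$. *)
Lemma same_coset_lasso z w (a : {path I from x to z in X})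
    (d e : {path I from z to w in X}) :
  H (loop_class (concat (concat a (concat d (reverse e))) (reverse a))) ->
  same_coset (concat a d) (concat a e).
Proof.
rewrite /same_coset; congr H; apply/loop_classP.
by rewrite reverse_concat !concatA; exact: path_homotopic_refl.
Qed.

Lemma coset_of_path_eq z (a b : {path I from x to z in X}) :
  coset_of_path a = coset_of_path b <-> same_coset a b.
Proof.
split=> [ab|ab].
  have : same_coset a = same_coset b.
    (* The classes have types depending on the endpoint, so their equality is extracted from an
       equality of dependent pairs. *)
    exact: (existT_inj2 (congr1 (fun y => existT
      (fun z => set {path I from x to z in X})
      (cover_proj y) (@cover_coset y)) ab)).
  move=> ->; exact/homotopic_same_coset/path_homotopic_refl.
apply/coset_cover_eq/seteqP; split=> c /= ac.
  exact: same_coset_trans (same_coset_sym ab) ac.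
exact: same_coset_trans ab ac.
Qed.

Lemma coset_of_path_ext z w (a : {path I from x to z in X})
    (b : {path I from x to w in X}) :
  z = w -> a =1 b -> coset_of_path a = coset_of_path b.
Proof. by move=> zw; subst w => /path_eqP ->. Qed.

Lemma homotopic_coset_of_path z (a b : {path I from x to z in X}) :
  path_homotopic a b -> coset_of_path a = coset_of_path b.
Proof. by move=> ab; apply/coset_of_path_eq; exact: homotopic_same_coset. Qed.

(** * Sheets and openness of the projection *)

Definition sheet z (a : {path I from x to z in X}) (U : set X) :
    set coset_cover :=
  [set y | exists w (d : {path I from z to w in X}),
     range d `<=` U /\ y = coset_of_path (concat a d)].

(** Two successive whiskers within [U] form one whisker within [U]. This gives both the openness of
    sheets and the last clause of [cover_chart]. *)
Lemma sheet_extend z w v (a : {path I from x to z in X})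
    (c : {path I from x to w in X}) (e : {path I from w to v in X}) U :
  range e `<=` U -> sheet a U (coset_of_path c) ->
  sheet a U (coset_of_path (concat c e)).
Proof.
move=> eU [w' [d [dU E]]]; have ww' : w = w' := congr1 cover_proj E.
subst w'; exists v, (concat d e); split; first exact: range_concat.
rewrite (homotopic_coset_of_path (concatA a d e)).
apply/coset_of_path_eq/same_coset_concat; exact/coset_of_path_eq.
Qed.

Lemma sheet_open z (a : {path I from x to z in X}) U :
  open U -> open (sheet a U).
Proof.
move=> oU; rewrite cover_openE => w c ca; exists U; split=> //; last first.
  by move=> v e eU; exact: sheet_extend.
have [w' [d [dU E]]] := ca; have ww' : w = w' := congr1 cover_proj E.
by subst w'; apply: dU; exists one => //; exact: path_one.
Qed.

Lemma sheet_center z (a : {path I from x to z in X}) (U : set X) :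
  U z -> sheet a U (coset_of_path a).
Proof.
move=> Uz; exists z, (const_path z); split; first exact: range_const_path.
by apply/esym/homotopic_coset_of_path; exact: concat_constr.
Qed.

Hypothesis lpc_X : locally_path_connected R X.

Lemma cover_proj_open O : open O -> open (cover_proj @` O).
Proof.
rewrite cover_openE => oO; rewrite openE => _ [y Oy <-].
elim/coset_cover_ind: y Oy => z a.
move=> /oO[U [oU Uz UO]] /=.
(* Shrinking to a path connected [W] makes every nearby point the end of a whisker inside [U]. *)
have [W [oW Wz WU cW]] := lpc_X (open_nbhs_nbhs (conj oU Uz)).
rewrite /interior; apply: filterS (open_nbhs_nbhs (conj oW Wz)) => w Ww.
have [d dW] := cW _ _ Wz Ww.
exists (coset_of_path (concat a d)) => //.
by apply: UO; exact: subset_trans dW WU.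
Qed.

(** * Charts from the path open cover *)

Variable V : path_space R x -> set X.
Hypothesis cover_V : path_open_cover V.
Hypothesis spanier_V : path_spanier V `<=` H.

Lemma path_space_subproof z (a : {path I from x to z in X}) :
  (a : I -> X) \in pointed_maps (zero : I) x.
Proof. by apply/mem_set; split; [exact: cts_fun | exact: path_zero]. Qed.

Definition to_path_space z (a : {path I from x to z in X}) : path_space R x :=
  exist (fun h => h \in pointed_maps (zero : I) x) _ (path_space_subproof a).

Lemma lasso_in_H z (a : {path I from x to z in X})
    (v : {path I from z to z in X}) :
  range v `<=` V (to_path_space a) ->
  H (loop_class (concat (concat a v) (reverse a))).
Proof.
move=> vV; apply: spanier_V; pose u := to_path_space a.
(* The endpoint of [u] equals [z] only up to a proof, so [v] is retyped as a loop at [endpoint u];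
   the lasso is then a product with one factor. *)
have uz : z = endpoint u by rewrite /endpoint /= path_one.
have v0 : v zero = endpoint u by rewrite path_zero.
have v1 : v one = endpoint u by rewrite path_one.
pose v' : {path I from endpoint u to endpoint u in X} :=
  mk_path (@cts_fun _ _ v) v0 v1.
exists 1, (fun=> u), (fun=> v'); split=> //.
rewrite big_ord_recl big_ord0 mulg1; congr loop_class; exact/path_eqP.
Qed.

(** Two whiskers in [V (to_path_space a)] with the same end differ by a loop in that set, whose
    lasso lies in [H]; hence the sheet injects into [X]. The last clause lets a path staying in [W]
    carry membership in [B] along. *)
Lemma cover_chart (y : coset_cover) : exists (B : set coset_cover) (W : set X),
  [/\ open_nbhs y B, {in B &, injective cover_proj}, open W, W (cover_proj y)
    & forall w v (c : {path I from x to w in X}) (e : {path I from w to v in X}),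
      range e `<=` W -> B (coset_of_path c) -> B (coset_of_path (concat c e))].
Proof.
elim/coset_cover_ind: y => z a; have [oV _ Vend] := cover_V.
have Vz : V (to_path_space a) z.
  by have := Vend (to_path_space a); rewrite /endpoint /= path_one.
exists (sheet a (V (to_path_space a))), (V (to_path_space a)); split => //.
- by split; [exact/sheet_open/oV | exact: sheet_center].
- move=> y y' /set_mem[w [d [dV ->]]] /set_mem[w' [d' [dV' ->]]] /= ww'.
  subst w'; apply/coset_of_path_eq/same_coset_lasso/lasso_in_H.
  by apply: range_concat => //; exact: range_reverse.
- by move=> w v c e eV; exact: sheet_extend.
Qed.

Lemma cover_proj_local_homeomorphism : local_homeomorphism cover_proj.
Proof.
apply: open_injective_local_homeomorphism.
- exact: cover_proj_continuous.
- exact: cover_proj_open.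
- by move=> y; have [B [W [yB injB _ _ _]]] := cover_chart y; exists B.
Qed.

(** * Existence, joint continuity and uniqueness of path lifts *)

Section Lift.
Context z (a : {path I from x to z in X}).
Implicit Type f : path_space R z.

Definition cover_lift f (t : I) : coset_cover :=
  coset_of_path (concat a
    (subpath (@path_of_continuous R X z f) (path_of0 f)
      (erefl ((\val f : I -> X) t)))).

Lemma cover_lift_extend f s t :
  cover_lift f t = coset_of_path (concat
    (concat a (subpath (@path_of_continuous R X z f) (path_of0 f)
      (erefl ((\val f : I -> X) s))))
    (subpath (@path_of_continuous R X z f) (erefl ((\val f : I -> X) s))
      (erefl ((\val f : I -> X) t)))).
Proof.
apply: homotopic_coset_of_path.
by rewrite -concatA subpath_concat; exact: path_homotopic_refl.
Qed.

Lemma coset_of_path_concat_cst w (d : {path I from z to w in X}) :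
  (forall t, d t = z) -> coset_of_path (concat a d) = coset_of_path a.
Proof.
move=> dz; have zw : w = z by rewrite -(dz one) path_one.
subst w; rewrite (_ : d = const_path z); last exact/path_eqP.
by apply: homotopic_coset_of_path; exact: concat_constr.
Qed.

Lemma cover_lift0 f : cover_lift f zero = coset_of_path a.
Proof.
apply: coset_of_path_concat_cst => t; rewrite -[LHS]/((\val f : I -> X) (clamp _)).
by rewrite subrr mul0r add0r clamp_ival path_of0.
Qed.

(** By continuity of evaluation, every [f] near [f0] maps an interval [J] around [t0] into [W], so
    its pieces between times of [J] are whiskers there. The point [y] may be any point over [f0] at
    [t0]: continuity takes the lift itself, uniqueness a value of a given lift. *)
Lemma cover_lift_local f0 t0 (y : coset_cover) :
  cover_proj y = (\val f0 : I -> X) t0 ->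
  exists (B : set coset_cover) (J : set I),
  [/\ open_nbhs y B, {in B &, injective cover_proj}, nbhs t0 J
    & \forall f \near f0, forall s t, J s -> J t ->
        B (cover_lift f s) -> B (cover_lift f t)].
Proof.
move=> yt0; have [B [W [By injB oW Wt0 BW]]] := cover_chart y.
rewrite yt0 in Wt0.
have := pointed_eval_continuous (z := zero : I) (y := z)
  unit_interval_locally_compact unit_interval_regular.
move=> /(_ (f0, t0) W (open_nbhs_nbhs (conj oW Wt0))) /=.
case=> -[N J0] [/= Nf0 /nbhs_ivalP[e e0 eJ0]] NJ0.
exists B, [set s | `|ival s - ival t0| < e]; split=> //.
  apply: open_nbhs_nbhs; split; first exact: ball_ival_open.
  by rewrite /= subrr normr0.
apply: filterS Nf0 => f Nf s t Js Jt Bs; rewrite (cover_lift_extend _ s).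
apply: BW Bs => _ [r _ <-]; apply: (NJ0 (f, segment s t r)); split=> //=.
by apply: eJ0; exact: segment_ball.
Qed.

Lemma cover_lift_continuous :
  continuous (fun ft : path_space R z * I => cover_lift ft.1 ft.2).
Proof.
move=> [f0 t1]; pose E := fun ft : path_space R z * I => cover_lift ft.1 ft.2.
pose S := [set t | {for f0, continuous (cover_lift^~ t)}].
(* Continuity in the path alone at one time [s] of [J] yields joint continuity at all times of
   [J]. *)
have key (t0 : I) : exists2 J : set I, nbhs t0 J &
    forall s t, J s -> J t -> S s -> {for (f0, t), continuous E}.
  have [B [J0 [[oB Bt0] injB J0t0 near_f0]]] :=
    @cover_lift_local f0 t0 (cover_lift f0 t0) erefl.
  have [J [oJ Jt0 JJ0]] : exists J, [/\ open J, J t0 & J `<=` J0].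
    by move: J0t0; rewrite nbhsE => -[J [oJ Jt0] JJ0]; exists J.
  exists J; first exact: open_nbhs_nbhs.
  move=> s t Js Jt Ss O.
  have Bf0 u : J u -> B (cover_lift f0 u).
    move=> Ju; apply: (nbhs_singleton near_f0 t0) => //; exact: JJ0.
  rewrite nbhsE => -[O' [oO' O't] O'O].
  (* As the projection is open, for [(f, u)] near [(f0, t)] the value of [f] at [u] lies under some
     point of [O'] in the chart. *)
  have ev : nbhs (f0, t) [set ft : path_space R z * I |
      (cover_proj @` (O' `&` B)) ((\val ft.1 : I -> X) ft.2)].
    apply: (pointed_eval_continuous (z := zero : I) (y := z)
      unit_interval_locally_compact unit_interval_regular).
    apply: open_nbhs_nbhs; split; first exact/cover_proj_open/openI.
    by exists (cover_lift f0 t) => //; split=> //; exact: Bf0.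
  have Bs : \forall f \near f0, B (cover_lift f s).
    by apply: Ss; apply: open_nbhs_nbhs; split=> //; exact: Bf0.
  have prod : nbhs (f0, t) [set ft : path_space R z * I |
      [/\ J ft.2, B (cover_lift ft.1 s) & forall s t, J0 s -> J0 t ->
        B (cover_lift ft.1 s) -> B (cover_lift ft.1 t)]].
    exists ([set f | B (cover_lift f s)] `&` [set f | forall s t, J0 s -> J0 t ->
        B (cover_lift f s) -> B (cover_lift f t)], J).
      by split; [exact: filterI | exact: open_nbhs_nbhs].
    by move=> [f u] /= [[]].
  rewrite nbhs_simpl /=.
  apply: filterS2 ev prod => -[f u] /= [b [O'b Bb] bf] [Ju Bfs].
  (* The lift also lies in [B], so injectivity identifies it with that point of [O']. *)
  move=> /(_ s u (JJ0 _ Js) (JJ0 _ Ju) Bfs) Bfu; apply: O'O.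
  by rewrite /E /= (injB (cover_lift f u) b) //; exact/mem_set.
have St : S = setT.
  apply: connected_locally_constant; first exact: unit_interval_connected.
    (* At time zero the lift does not depend on the path. *)
    exists zero; rewrite /S /=.
    have -> : cover_lift^~ zero = cst (coset_of_path a).
      by apply/funext => f; exact: cover_lift0.
    exact: cst_continuous.
  move=> t0; have [J Jt0 JE] := key t0; exists J => // s t Js Jt Ss.
  apply: (@continuous_comp _ _ _ (fun f => (f, t)) E).
    exact: pairr_continuous.
  exact: JE Ss.
have [J Jt1 JE] := key t1.
by apply: (JE t1 t1); rewrite ?St //; exact: nbhs_singleton.
Qed.

(** The lifts agree at time zero, and agreement is locally constant: agreement at one time keeps
    both lifts in a common chart nearby, where the projection is injective. *)
Lemma cover_lift_unique (g : path_space R (coset_of_path a)) (t : I) :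
  cover_lift (post_comp cover_proj g) t = (\val g : I -> coset_cover) t.
Proof.
pose f := post_comp cover_proj g : path_space R z; rewrite -/f.
have cg : continuous (\val g : I -> coset_cover) by exact: path_of_continuous.
suff : [set t | cover_lift f t = (\val g : I -> coset_cover) t] = setT.
  by move/seteqP => [_ /(_ t)]; exact.
apply: connected_locally_constant; first exact: unit_interval_connected.
  by exists zero; rewrite /= cover_lift0 path_of0.
move=> t0; have [B [J [[oB Bt0] injB Jt0 near_f]]] :=
  @cover_lift_local f t0 ((\val g : I -> coset_cover) t0) erefl.
exists (J `&` (\val g : I -> coset_cover) @^-1` B).
  by apply: filterI => //; apply: cg; exact: open_nbhs_nbhs.
move=> s u [Js Bs] [Ju Bu] /= fs.
have Bfu : B (cover_lift f u).
  by apply: (nbhs_singleton near_f s) => //; rewrite fs.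
by apply: injB => //; exact/mem_set.
Qed.

Lemma cover_lift_subproof f : cover_lift f \in
  pointed_maps (zero : I) (coset_of_path a).
Proof.
apply/mem_set; split; last exact: cover_lift0.
move=> t; apply: (@continuous_comp _ _ _ (fun t => (f, t))
  (fun ft : path_space R z * I => cover_lift ft.1 ft.2)).
  exact: pairl_continuous.
exact: cover_lift_continuous.
Qed.

End Lift.

(** * The semicovering and its image *)

Lemma cover_path_lifting : continuous_path_lifting cover_proj R.
Proof.
move=> y; split.
  apply: post_comp_continuous.
    exact: unit_interval_locally_compact.
  exact: unit_interval_regular.
elim/coset_cover_ind: y => z a.
exists (fun f : path_space R z =>
  exist (fun h => h \in pointed_maps (zero : I) (coset_of_path a)) _
    (cover_lift_subproof a f)); split.
- by move=> g; apply: val_inj; apply/funext => t; exact: cover_lift_unique.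
(* The class at time [t] has the value of [f] at [t] as its endpoint, so projecting the lift returns
   [f] by conversion. *)
- by move=> f; apply: val_inj.
- by apply: pointed_maps_continuous; exact: cover_lift_continuous.
Qed.

Lemma cover_semicovering : semicovering cover_proj R.
Proof.
split; first exact: cover_proj_local_homeomorphism.
  exact: cover_path_lifting.
exact/path_lifting_homotopy_lifting/cover_path_lifting.
Qed.

(** The lift of [l] from the coset of the constant path ends at the coset of [l], and these cosets
    agree exactly when the class of [l] is in [H]. *)
Lemma cover_lift_loop (l : {path I from x to x in X}) :
  cover_lift (const_path x) (to_path_space l) one = coset_of_path (const_path x)
  <-> H (loop_class l).
Proof.
have -> : cover_lift (const_path x) (to_path_space l) one =
    coset_of_path (concat (const_path x) l).
  apply: coset_of_path_ext; first exact: path_one.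
  move=> t; rewrite /concat /= /mk_path /concat_fun; case: ifP => // _.
  rewrite -[LHS]/(l (clamp _)) ival1 ival0 subr0 mul1r addr0.
  by rewrite clamp_ival.
rewrite coset_of_path_eq /same_coset.
have -> : reverse (const_path x) = const_path x :> {path I from x to x in X}.
  exact/path_eqP.
suff -> : loop_class (concat (concat (const_path x) l) (const_path x)) =
  loop_class l by [].
apply/loop_classP; rewrite concat_constr concat_constl.
exact: path_homotopic_refl.
Qed.

Lemma cover_image : range (@pi1_map R coset_cover X cover_proj
  (coset_of_path (const_path x)) x erefl) = H.
Proof.
apply/seteqP; split=> [_ [b _ <-]|h Hh].
  rewrite -(loop_class_repr b); move: (repr b) => l; rewrite pi1_mapE.
  (* A loop upstairs is, by uniqueness, the lift of its image, so this lift closes up. *)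
  apply/cover_lift_loop.
  have lP : (l : I -> coset_cover) \in
      pointed_maps (zero : I) (coset_of_path (const_path x)).
    by apply/mem_set; split; [exact: cts_fun | exact: path_zero].
  pose g : path_space R (coset_of_path (const_path x)) :=
    exist (fun h => h \in pointed_maps (zero : I) _) _ lP.
  have g1 : (\val g : I -> coset_cover) one = coset_of_path (const_path x).
    by rewrite /= path_one.
  apply: etrans (etrans (cover_lift_unique g one) g1).
  by congr (cover_lift _ _ _); exact: val_inj.
rewrite -(loop_class_repr h) in Hh *; move: (repr h) Hh => l /cover_lift_loop l1.
have [cl l0] := set_mem (cover_lift_subproof (const_path x) (to_path_space l)).
exists (loop_class (mk_path cl l0 l1)) => //.
by rewrite pi1_mapE; congr loop_class; exact/path_eqP.
Qed.

End CosetCover.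

Theorem theorem4p1 (R : realType) (X : topologicalType)
    (conn_X : connected [set: X]) (lpc_X : locally_path_connected R X)
    (x : X) (H : set (pi1 R x)) (sub_H : group_closed (mem H)) :
  (exists (Y : topologicalType) (p : continuousType Y X),
     semicovering p R /\
     exists (y : Y) (pyx : p y = x),
       range (pi1_map (R := R) pyx) = H)
  <->
  (exists V : path_space R x -> set X,
     path_open_cover V /\ path_spanier V `<=` H).
Proof.
split=> [[Y [p [semi [y [pyx imH]]]]]|[V [cover_V spanier_V]]].
  (* After substitution [H] is the image itself and the base point equation is [erefl]. *)
  by subst x H; exact: semicovering_spanier.
exists (coset_cover H), (@cover_proj R X x H); split.
  exact: (@cover_semicovering R X x H sub_H lpc_X V).
exists (coset_of_path H (const_path x)), erefl.
exact: (@cover_image R X x H sub_H lpc_X V).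
Qed.
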